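(* Let $\Omega\subset\mathbb{R}^d$, $d\in\{2,3\}$, be an open connected bounded domain with smooth boundary, and let $W$ be a given smooth real-valued function on $\partial\Omega$. Let $Z_1,Z_2>0$ be fixed positive constants (independent of $\epsilon$). For each $\epsilon>0$ let $\Phi^*_\epsilon$ be the unique solution of the Poisson-Boltzmann equation $$-\epsilon\Delta\Phi^*_\epsilon=\rho^*_\epsilon\quad\text{in }\Omega,\qquad \rho^*_\epsilon=\frac{e^{-\Phi^*_\epsilon}}{Z_1}-\frac{e^{\Phi^*_\epsilon}}{Z_2},$$ with boundary condition $\Phi^*_\epsilon|_{\partial\Omega}=W$. Then for each compact subset $K\subset\Omega$, $$\lim_{\epsilon\to0}\ \sup_{x\in K}|\rho^*_\epsilon(x)|=0.$$
   Context: The function $W$ does not depend on $\epsilon$. ''Solution'' means a smooth (classical) solution on $\overline\Omega$; for each $\epsilon>0$ a unique solution of this boundary value problem exists. *)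

(* Defs.v *)
From HB Require Import structures.
From mathcomp Require Import all_boot all_order all_algebra.
From mathcomp Require Import all_classical all_reals all_analysis.
Set Implicit Arguments.
Unset Strict Implicit.
Unset Printing Implicit Defensive.
Import Order.TTheory GRing.Theory Num.Theory.
Import numFieldNormedType.Exports.
Local Open Scope classical_set_scope.
Local Open Scope ring_scope.

(* R^d is 'rV[R]_d; the library's norm there is the max norm, which induces
   the Euclidean topology. *)

Definition partial (R : realType) (d : nat) (i : 'I_d) (f : 'rV[R]_d -> R) :
    'rV[R]_d -> R :=
  'D_(delta_mx ord0 i) f.

(* partials [:: i1; ..; ik] f is d/dx_i1 (.. (d/dx_ik f)). *)
Definition partials (R : realType) (d : nat) (s : seq 'I_d)
    (f : 'rV[R]_d -> R) : 'rV[R]_d -> R :=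
  foldr (@partial R d) f s.

Definition laplacian (R : realType) (d : nat) (f : 'rV[R]_d -> R) :
    'rV[R]_d -> R :=
  fun x => \sum_(i < d) partial i (partial i f) x.

(* Meant for open U: partial derivatives of all orders exist and are
   continuous at every point of U. *)
Definition smooth_open (R : realType) (d : nat) (U : set 'rV[R]_d)
    (f : 'rV[R]_d -> R) : Prop :=
  forall (s : seq 'I_d) (x : 'rV[R]_d), U x ->
    {for x, continuous (partials s f)} /\
    forall i : 'I_d, derivable (partials s f) x (delta_mx ord0 i).

(* Smoothness on an arbitrary set A: near each point of A, the restriction of f
   to A has a smooth extension. Only the values of f on A matter. For A open
   this is smooth_open; for A the closure of a smooth domain it is smoothness up
   to the boundary; for A a smooth hypersurface it is smoothness on the
   submanifold. *)
Definition smooth_on (R : realType) (d : nat) (A : set 'rV[R]_d)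
    (f : 'rV[R]_d -> R) : Prop :=
  forall p : 'rV[R]_d, A p ->
    exists (U : set 'rV[R]_d) (g : 'rV[R]_d -> R),
      [/\ open U, U p, smooth_open U g &
          forall x, A x -> U x -> f x = g x].

Definition boundary (R : realType) (d : nat) (Omega : set 'rV[R]_d) :
    set 'rV[R]_d :=
  closure Omega `\` interior Omega.

(* Near each boundary point, Omega is the negativity set of a smooth function
   with nonvanishing gradient. *)
Definition smooth_boundary (R : realType) (d : nat) (Omega : set 'rV[R]_d) :
    Prop :=
  forall p : 'rV[R]_d, boundary Omega p ->
    exists (U : set 'rV[R]_d) (phi : 'rV[R]_d -> R),
      [/\ open U, U p, smooth_open U phi,
          forall x, U x -> exists i : 'I_d, partial i phi x != 0 &
          forall x, U x -> (Omega x <-> phi x < 0)].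

Definition pb_density (R : realType) (d : nat) (Z1 Z2 : R)
    (Phi : 'rV[R]_d -> R) : 'rV[R]_d -> R :=
  fun x => expR (- Phi x) / Z1 - expR (Phi x) / Z2.

Definition pb_solution (R : realType) (d : nat) (Omega : set 'rV[R]_d)
    (W : 'rV[R]_d -> R) (Z1 Z2 eps : R) (Phi : 'rV[R]_d -> R) : Prop :=
  [/\ smooth_on (closure Omega) Phi,
      forall x, Omega x -> - eps * laplacian Phi x = pb_density Z1 Z2 Phi x &
      forall x, boundary Omega x -> Phi x = W x].

(* Main.v *)
Require Import Defs.
From HB Require Import structures.
From mathcomp Require Import all_boot all_order all_algebra.
From mathcomp Require Import all_classical all_reals all_analysis.
From mathcomp Require Import ring lra.
Set Implicit Arguments.
Unset Strict Implicit.
Unset Printing Implicit Defensive.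
Import Order.TTheory GRing.Theory Num.Theory.
Import numFieldNormedType.Exports.
Local Open Scope classical_set_scope.
Local Open Scope ring_scope.

(** The density is [rho = - F (Phi)] with [F s = expR s / Z2 - expR (- s) / Z1]
    increasing, and the equation reads [eps * laplacian Phi = F (Phi)].  The
    proof is a comparison with a paraboloid, and gives the rate
    [|rho| <= 2 d k eps] on [K], with [k] independent of [eps].

    Fix [x0] in [K] at distance at least [r] from the boundary and suppose
    [F (Phi x0) > 0], that is, [Phi x0 > c] where [c] is the zero of [F].  Let
    [y] maximise [Phi - k |x - x0|^2] over the closure of [Omega].  The value at
    [x0] exceeds [c], whereas on the boundary the function is at most
    [sup W - k r^2]; so once [k r^2 >= sup W - c] the point [y] is interior.
    There the second derivatives give [laplacian Phi y <= 2 d k], and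
    [Phi y >= Phi x0], so by monotonicity
    [F (Phi x0) <= F (Phi y) = eps * laplacian Phi y <= 2 d k eps]
    (lemmas [interior_touching_point] and [semilinear_interior_bound]).
    The lower bound for [F (Phi x0)] is the same statement for [- Phi], which
    solves the problem with [Z1] and [Z2] exchanged.  Compactness of [K] makes
    [r], hence [k], uniform in [x0]. *)

(** * Second derivatives at a maximum *)

(** Since [df 0 = 0], a positive second derivative would make [df] positive
    just to the right of [0], and the mean value theorem would then push [f]
    above [f 0] there. *)
Lemma second_derivative_le0_at_max (R : realType) (f df : R -> R) (e d2 : R) :
  0 < e ->
  (forall t : R, `|t| < e -> is_derive t 1 f (df t)) ->
  is_derive (0 : R) 1 df d2 ->
  (forall t : R, `|t| < e -> f t <= f 0) ->
  d2 <= 0.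
Proof.
move=> e0 fdf dfd2 fmax.
have inball t : t \in `](- e), e[ -> `|t| < e by rewrite in_itv /= ltr_norml.
have df0 : df 0 = 0.
  have f'0 : is_derive (0 : R) 1 f 0.
    apply: (@derive1_at_max _ f (- e) e 0).
    - by lra.
    - by move=> t /inball te; have [] := fdf t te.
    - by rewrite in_itv /= oppr_lt0 e0.
    - by move=> t /inball; exact: fmax.
  have f'df : is_derive (0 : R) 1 f (df 0) by apply: fdf; rewrite normr0.
  by rewrite -(@derive_val _ _ _ _ _ _ _ f'df) (@derive_val _ _ _ _ _ _ _ f'0).
rewrite leNgt; apply/negP => d2gt0.
have [dfcvg dfE] := dfd2.
have quotient_gt0 : \forall h \near (0 : R)^',
    0 < h^-1 *: (df (h *: 1 + 0) - df 0).
  have cv : h^-1 *: (df (h *: 1 + 0) - df 0) @[h --> (0 : R)^'] --> d2.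
    by rewrite -dfE; exact: dfcvg.
  exact: (cvgr_gt _ cv).
move: quotient_gt0 => [/= r r0 quotient_gt0].
have df_gt0 h : 0 < h -> h < r -> 0 < df h.
  move=> h0 hr; have := quotient_gt0 h; rewrite /= sub0r normrN gtr0_norm//.
  move=> /(_ hr (lt0r_neq0 h0)).
  by rewrite df0 subr0 addr0 [h *: 1]mulr1 pmulr_rgt0 // invr_gt0.
(* Halving keeps h strictly inside both the interval where f is
   differentiable and the one where df is positive. *)
pose h := Num.min r e / 2.
have m0 : 0 < Num.min r e by rewrite lt_min r0.
have mr : Num.min r e <= r by rewrite ge_min lexx.
have me : Num.min r e <= e by rewrite ge_min lexx orbT.
have h0 : 0 < h by rewrite /h; lra.
have hr : h < r by rewrite /h; lra.
have he : h < e by rewrite /h; lra.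
have [||c] := @MVT _ f df 0 h h0.
- move=> x; rewrite in_itv /= => /andP[x0 xh]; apply: fdf.
  by rewrite gtr0_norm//; lra.
- apply: derivable_within_continuous => x; rewrite in_itv /= => /andP[x0 xh].
  by have [] := fdf x _ => //; rewrite ger0_norm//; lra.
- rewrite in_itv /= => /andP[c0 ch] fE.
  have : 0 < df c * (h - 0) by rewrite subr0 mulr_gt0// df_gt0//; lra.
  rewrite -fE subr_gt0 ltNge fmax// gtr0_norm//.
Qed.

Lemma is_derive_sub_parabola (R : realType) (g : R -> R) (dg b k t : R) :
  is_derive t 1 g dg ->
  is_derive t 1 (fun s => g s - (b * s + k * s ^+ 2)) (dg - (b + k * (2 * t))).
Proof.
move=> dgt; have did := is_derive_id t (1 : R).
have -> : (fun s => g s - (b * s + k * s ^+ 2)) =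
    g - (b \*: id + k \*: (id ^+ 2)) :> (R -> R).
  by apply/funext => s; rewrite !fctE.
apply: (is_derive_eq (is_deriveB dgt
  (is_deriveD (is_deriveZ b did) (is_deriveZ k (is_deriveX 2 did))))).
rewrite /GRing.scale /=; ring.
Qed.

Lemma is_derive_sub_affine (R : realType) (g : R -> R) (dg b k t : R) :
  is_derive t 1 g dg ->
  is_derive t 1 (fun s => g s - (b + k * s)) (dg - k).
Proof.
move=> dgt; have did := is_derive_id t (1 : R).
have -> : (fun s => g s - (b + k * s)) = g - (cst b + k \*: id) :> (R -> R).
  by apply/funext => s; rewrite !fctE.
apply: (is_derive_eq (is_deriveB dgt
  (is_deriveD (is_derive_cst b t 1) (is_deriveZ k did)))).
by rewrite add0r /GRing.scale /= mulr1.
Qed.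

(** Turns directional derivatives into one-variable ones, so that the
    one-dimensional test applies along each coordinate axis. *)
Lemma is_derive_line (R : realType) (V : normedModType R) (f : V -> R)
    (y v : V) (t : R) :
  derivable f (t *: v + y) v ->
  is_derive t 1 (fun s => f (s *: v + y)) ('D_v f (t *: v + y)).
Proof.
have quotientE :
    (fun h : R => h^-1 *: (((fun s => f (s *: v + y)) \o shift t) (h *: 1) -
                           f (t *: v + y))) =
    (fun h : R => h^-1 *: ((f \o shift (t *: v + y)) (h *: v) -
                           f (t *: v + y))).
  by apply/funext => h; rewrite /= [h *: 1]mulr1 scalerDl addrA.
by move=> dfv; split; rewrite /derivable /derive quotientE.
Qed.

(** The square of the Euclidean distance, used in place of the ambient max
    norm because it is a polynomial with constant second derivatives. *)
Definition sqdist (R : realType) (d : nat) (x0 x : 'rV[R]_d) : R :=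
  \sum_(i < d) (x ord0 i - x0 ord0 i) ^+ 2.

Lemma sqdist_ge0 (R : realType) (d : nat) (x0 x : 'rV[R]_d) : 0 <= sqdist x0 x.
Proof. by apply: sumr_ge0 => i _; exact: sqr_ge0. Qed.

Lemma sqdistxx (R : realType) (d : nat) (x : 'rV[R]_d) : sqdist x x = 0.
Proof. by rewrite /sqdist big1 // => i _; rewrite subrr expr0n. Qed.

Lemma sqdist_line (R : realType) (d : nat) (x0 y : 'rV[R]_d) (i : 'I_d)
    (t : R) :
  sqdist x0 (t *: delta_mx ord0 i + y) =
  sqdist x0 y + (y ord0 i - x0 ord0 i) *+ 2 * t + t ^+ 2.
Proof.
rewrite /sqdist (bigD1 i) //= [in RHS](bigD1 i) //=.
rewrite !mxE !eqxx /= mulr1.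
rewrite (eq_bigr (fun j => (y ord0 j - x0 ord0 j) ^+ 2)); last first.
  by move=> j /negPf ji; rewrite !mxE ji andbF mulr0 add0r.
ring.
Qed.

(** Balls are those of the max norm, so a point outside the ball already has
    one coordinate at distance at least [r]. *)
Lemma sqdist_notin_ball (R : realType) (d : nat) (x0 x : 'rV[R]_d) (r : R) :
  0 < r -> ~ ball x0 r x -> r ^+ 2 <= sqdist x0 x.
Proof.
move=> r0; rewrite leNgt => xr; apply/negP => dx; apply: xr; split=> // i j.
rewrite (ord1 i) /ball /= ltNge; apply/negP => rle.
move: dx; rewrite ltNge => /negP; apply.
rewrite /sqdist (bigD1 j) //= -[leLHS]addr0 lerD//.
  by rewrite -[leRHS]real_normK ?num_real// distrC lerXn2r// nnegrE// ltW.
by apply: sumr_ge0 => k _; exact: sqr_ge0.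
Qed.

Lemma continuous_sqdist (R : realType) (d : nat) (x0 : 'rV[R]_d) :
  continuous (sqdist x0).
Proof.
have addc : continuous (fun z : R * R => z.1 + z.2) by exact: add_continuous.
apply: (@continuous_big R 'I_d +%R 0 xpredT addc 'rV[R]_d (index_enum 'I_d)
  (fun i x => (x ord0 i - x0 ord0 i) ^+ 2)) => i _ x.
apply: (@continuous_comp _ _ _ (fun x : 'rV[R]_d => x ord0 i - x0 ord0 i)
  (fun t : R => t ^+ 2)); last exact: exprn_continuous.
by apply: continuousB; [exact: coord_continuous|exact: cst_continuous].
Qed.

(** Along the [i]-th axis through [y] the paraboloid is a quadratic polynomial
    with second derivative [2 * k], and subtracting it from [u] leaves a
    function of one variable with a maximum at [0]. *)
Lemma partial2_le_at_touching (R : realType) (d : nat) (u : 'rV[R]_d -> R)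
    (x0 y : 'rV[R]_d) (k : R) (i : 'I_d) :
  (\forall x \near y, derivable u x (delta_mx ord0 i)) ->
  derivable (partial i u) y (delta_mx ord0 i) ->
  (\forall x \near y, u x - k * sqdist x0 x <= u y - k * sqdist x0 y) ->
  partial i (partial i u) y <= 2 * k.
Proof.
set v : 'rV[R]_d := delta_mx ord0 i => du ddu umax.
have line_cvg : (fun t : R => t *: v + y) t @[t --> (0 : R)] --> y.
  suff : (fun t : R => t *: v + y) t @[t --> (0 : R)] --> 0 *: v + y.
    by rewrite scale0r add0r.
  apply: (@continuousD _ _ _ (fun t : R => t *: v) (fun=> y)).
    exact: scalel_continuous.
  exact: cst_continuous.
have [e /= e0 near_line] : \forall t \near (0 : R),
    derivable u (t *: v + y) v /\
    u (t *: v + y) - k * sqdist x0 (t *: v + y) <= u y - k * sqdist x0 y.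
  exact: (line_cvg _ (filterI du umax)).
(* b * t + k * t ^+ 2 is the variation of k * sqdist x0 along the line. *)
pose b := k * (y ord0 i - x0 ord0 i) *+ 2.
pose f := fun t : R => u (t *: v + y) - (b * t + k * t ^+ 2).
pose df := fun t : R => partial i u (t *: v + y) - (b + k * (2 * t)).
have near_line_at t : `|t| < e -> derivable u (t *: v + y) v /\
    u (t *: v + y) - k * sqdist x0 (t *: v + y) <= u y - k * sqdist x0 y.
  by move=> te; apply: near_line; rewrite /= sub0r normrN.
suff : partial i (partial i u) y - 2 * k <= 0 by lra.
apply: (@second_derivative_le0_at_max _ f df e _ e0).
- move=> t /near_line_at[dut _].
  exact: is_derive_sub_parabola (is_derive_line dut).
- have ddu0 : derivable (partial i u) (0 *: v + y) v by rewrite scale0r add0r.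
  have := is_derive_sub_affine b (2 * k) (is_derive_line ddu0).
  rewrite scale0r add0r.
  have -> // : (fun s : R => partial i u (s *: v + y) - (b + 2 * k * s)) = df.
  by apply/funext => s; rewrite /df mulrA (mulrC k).
- move=> t /near_line_at[_].
  rewrite /f /b scale0r add0r sqdist_line; lra.
Qed.

(** * Consequences of smoothness up to the boundary *)

Lemma smooth_on_continuous (R : realType) (d : nat) (A : set 'rV[R]_d)
    (f : 'rV[R]_d -> R) :
  smooth_on A f -> {within A, continuous f}.
Proof.
move=> fA; apply/subspace_continuousP => x Ax.
have [U [g [oU Ux gU fg]]] := fA x Ax.
have [gc _] := gU [::] x Ux.
have : f y @[y --> within A (nbhs x)] --> g x; last by rewrite -fg.
apply: (@cvg_trans _ (g y @[y --> within A (nbhs x)])).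
  apply: near_eq_cvg; apply: filterS (open_nbhs_nbhs (conj oU Ux)) => y Uy Ay.
  by rewrite fg.
by apply: cvg_trans gc; apply: cvg_app; exact: cvg_within.
Qed.

(** The derivatives required by the comparison argument, kept separate from
    [smooth_on] because they pass to [- u] without handling derivatives of all
    orders of local extensions. *)
Definition axis_derivable2 (R : realType) (d : nat) (u : 'rV[R]_d -> R)
    (x : 'rV[R]_d) : Prop :=
  forall i : 'I_d, derivable u x (delta_mx ord0 i) /\
    derivable (partial i u) x (delta_mx ord0 i).

(** Near an interior point of [A] the local extension coincides with [f], so
    its derivatives are those of [f]. *)
Lemma smooth_on_derivable2 (R : realType) (d : nat) (A : set 'rV[R]_d)
    (f : 'rV[R]_d -> R) (x : 'rV[R]_d) :
  smooth_on A f -> (interior A) x -> axis_derivable2 f x.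
Proof.
move=> fA Aox i; have [U [g [oU Ux gU fg]]] := fA x (interior_subset Aox).
have gf : \forall y \near x, g y = f y.
  have := open_nbhs_nbhs (conj oU Ux).
  by apply: filterS2 Aox => y Ay Uy; rewrite fg.
split.
  by apply: near_eq_derivable gf _; have [_] := gU [::] x Ux; exact.
have [_ /(_ i) dgi] := gU [:: i] x Ux.
apply: near_eq_derivable dgi.
by apply: filterS (near_join gf) => y gfy; exact: near_eq_derive.
Qed.

Lemma near_partialN (R : realType) (d : nat) (Omega : set 'rV[R]_d)
    (u : 'rV[R]_d -> R) (x : 'rV[R]_d) (i : 'I_d) :
  open Omega -> (forall x, Omega x -> axis_derivable2 u x) ->
  Omega x ->
  \forall y \near x, (- partial i u) y = partial i (- u) y.
Proof.
move=> oO du Ox; apply: filterS (open_nbhs_nbhs (conj oO Ox)) => y Oy.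
by rewrite /partial deriveN//; have [] := du y Oy i.
Qed.

Lemma axis_derivable2N (R : realType) (d : nat) (Omega : set 'rV[R]_d)
    (u : 'rV[R]_d -> R) (x : 'rV[R]_d) :
  open Omega -> (forall x, Omega x -> axis_derivable2 u x) ->
  Omega x -> axis_derivable2 (- u) x.
Proof.
move=> oO du Ox i; have [d1 d2] := du x Ox i; split; first exact: derivableN.
by apply: near_eq_derivable (near_partialN i oO du Ox) _; exact: derivableN.
Qed.

Lemma laplacianN (R : realType) (d : nat) (Omega : set 'rV[R]_d)
    (u : 'rV[R]_d -> R) (x : 'rV[R]_d) :
  open Omega -> (forall x, Omega x -> axis_derivable2 u x) ->
  Omega x -> laplacian (- u) x = - laplacian u x.
Proof.
move=> oO du Ox; rewrite /laplacian -sumrN; apply: eq_bigr => i _.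
have [_ d2] := du x Ox i.
by rewrite {1}/partial -(near_eq_derive _ (near_partialN i oO du Ox)) deriveN.
Qed.

(** * Compactness *)

Lemma bounded_closure (R : realType) (V : normedModType R) (A : set V) :
  bounded_set A -> bounded_set (closure A).
Proof.
rewrite /bounded_set /bounded_near; apply: filterS => M AM x.
move=> /(closure_subset AM).
exact: (preimage_closed (in1W (@norm_continuous _ _)) (@closed_le _ M)).
Qed.

(** The inclusion of a ball in [A] is stable under small changes of centre and
    radius, so compactness yields one radius for all of [K]. *)
Lemma compact_ball_sub_open (R : realType) (V : pseudoMetricType R)
    (K A : set V) :
  compact K -> open A -> K `<=` A ->
  exists2 r : R, 0 < r & forall x, K x -> ball x r `<=` A.
Proof.
move=> /compact_near_coveringP cK oA KA.
have : \forall r \near (0 : R)^'+, K `<=` [set x | ball x r `<=` A].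
  apply: (cK R (0 : R)^'+ (fun r x => ball x r `<=` A)) => x Kx.
  have /nbhs_ballP[e /= e0 xeA] := open_nbhs_nbhs (conj oA (KA x Kx)).
  have e20 : 0 < e / 2 by rewrite divr_gt0.
  exists (ball x (e / 2), [set r | r < e / 2]) => /=.
    by split; [exact: nbhsx_ballx|exact: nbhs_right_lt].
  move=> [y r] /= [xy re] z yz; apply: xeA.
  rewrite (splitr e); apply: ball_triangle xy _; exact: le_ball (ltW re) _ yz.
move=> nearr.
have [r [Kr r0]] : exists r, K `<=` [set x | ball x r `<=` A] /\ 0 < r.
  exact: filter_ex (filterI nearr (nbhs_right_gt 0)).
by exists r.
Qed.

Lemma boundary_data_bounded (R : realType) (d : nat) (Omega : set 'rV[R]_d)
    (W : 'rV[R]_d -> R) :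
  bounded_set Omega -> {within boundary Omega, continuous W} ->
  exists2 M : R, 0 < M & forall x, boundary Omega x -> `|W x| <= M.
Proof.
move=> bO cW.
have cptB : compact (boundary Omega).
  apply: bounded_closed_compact.
    move: (bounded_closure bO); rewrite /bounded_set /bounded_near.
    by apply: filterS => M clM x [clx _]; exact: clM.
  rewrite /boundary setDE; apply: closedI; first exact: closed_closure.
  by apply: open_closedC; exact: open_interior.
have [M M0 WM] :=
  ex_strict_bound_gt0 (compact_bounded (continuous_compact cW cptB)).
exists M => // x Bx; apply/ltW/WM; exact: imageP.
Qed.

(** * Comparison with a paraboloid *)

(** A paraboloid steep enough to lie above the boundary data touches [u] from
    above at an interior point.  The point [y] maximises
    [u - k * sqdist x0] over the closure of [Omega]; the strict inequality on
    [k] says that no boundary value of this function reaches its value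
    [u x0] at [x0]. *)
Lemma interior_touching_point (R : realType) (d : nat) (Omega : set 'rV[R]_d)
    (u : 'rV[R]_d -> R) (x0 : 'rV[R]_d) (r k M : R) :
  open Omega -> bounded_set Omega ->
  {within closure Omega, continuous u} ->
  (forall x, Omega x -> axis_derivable2 u x) ->
  (forall x, boundary Omega x -> u x <= M) ->
  0 < r -> ball x0 r `<=` Omega -> 0 <= k -> M - u x0 < k * r ^+ 2 ->
  exists y, [/\ Omega y, u x0 <= u y & laplacian u y <= d%:R * (2 * k)].
Proof.
move=> oO bO cu du uM r0 x0O k0 kbig.
have Ox0 : Omega x0 by apply: x0O; exact: ballxx.
have cptO : compact (closure Omega).
  apply: bounded_closed_compact; last exact: closed_closure.
  exact: bounded_closure.
pose h := fun x => u x - k * sqdist x0 x.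
have ch : {within closure Omega, continuous h}.
  move=> x; apply: cvgB; first exact: cu.
  apply: cvgM; first exact: cvg_cst.
  exact: (continuous_subspaceT (@continuous_sqdist _ _ x0)).
have [|y /set_mem clOy ymax] := EVT_max_rV _ cptO ch.
  by exists x0; exact: subset_closure.
have hx0 : h x0 <= h y by apply: ymax; apply/mem_set/subset_closure.
have hx0E : h x0 = u x0 by rewrite /h sqdistxx mulr0 subr0.
have Oy : Omega y.
  apply: contrapT => nOy.
  have By : boundary Omega y by split=> // /interior_subset.
  have := sqdist_notin_ball r0 (fun yb => nOy (x0O y yb)).
  move=> /(ler_wpM2l k0) kr; have := uM y By.
  move: hx0; rewrite hx0E /h; lra.
exists y; split=> //.
  have := mulr_ge0 k0 (sqdist_ge0 x0 y).
  by move: hx0; rewrite hx0E /h; lra.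
have nearO : \forall x \near y, Omega x by exact: open_nbhs_nbhs.
rewrite /laplacian mulr_natl -[X in _ *+ X]card_ord -sumr_const.
apply: ler_sum => i _; apply: (@partial2_le_at_touching _ _ _ x0).
- by apply: filterS nearO => x Ox; have [] := du x Ox i.
- by have [] := du y Oy i.
- by apply: filterS nearO => x Ox; apply: ymax; apply/mem_set/subset_closure.
Qed.

(** When [F (u x0) > 0] monotonicity forces [u x0 > c], so a steepness [k]
    chosen from [M], [c] and [r] alone suffices for a touching point, where the
    equation bounds [F (u y)], hence [F (u x0)]. *)
Lemma semilinear_interior_bound (R : realType) (d : nat) (Omega : set 'rV[R]_d)
    (u : 'rV[R]_d -> R) (F : R -> R) (eps c M r k : R) (x0 : 'rV[R]_d) :
  open Omega -> bounded_set Omega ->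
  {within closure Omega, continuous u} ->
  (forall x, Omega x -> axis_derivable2 u x) ->
  (forall x, boundary Omega x -> u x <= M) ->
  {homo F : s t / s <= t} -> F c <= 0 -> 0 <= eps ->
  (forall x, Omega x -> eps * laplacian u x = F (u x)) ->
  0 < r -> ball x0 r `<=` Omega -> 0 <= k -> M - c <= k * r ^+ 2 ->
  F (u x0) <= d%:R * (2 * k) * eps.
Proof.
move=> oO bO cu du uM Fhomo Fc eps0 equ r0 x0O k0 kbig.
have [F0|F0] := leP (F (u x0)) 0.
  by apply: le_trans F0 _; rewrite !mulr_ge0.
have cu0 : c < u x0.
  rewrite ltNge; apply/negP => /Fhomo Fle.
  by move: (le_trans Fle Fc); rewrite leNgt F0.
have [|y [Oy uy lapy]] :=
    @interior_touching_point _ _ _ u x0 r k M oO bO cu du uM r0 x0O k0.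
  by lra.
apply: le_trans (Fhomo _ _ uy) _.
by rewrite -equ// mulrC ler_wpM2r.
Qed.

(** * The Poisson-Boltzmann density *)

(** Minus the density as a function of the potential; the sign makes it
    nondecreasing and equal to [eps * laplacian Phi]. *)
Definition pb_rhs (R : realType) (Z1 Z2 s : R) : R :=
  expR s / Z2 - expR (- s) / Z1.

Lemma pb_densityE (R : realType) (d : nat) (Z1 Z2 : R) (Phi : 'rV[R]_d -> R) x :
  pb_density Z1 Z2 Phi x = - pb_rhs Z1 Z2 (Phi x).
Proof. by rewrite /pb_density /pb_rhs opprB. Qed.

(** Changing the sign of the potential exchanges the two species, so an upper
    bound on the density for all [Z1], [Z2] yields the lower bound. *)
Lemma pb_rhsN (R : realType) (Z1 Z2 s : R) :
  pb_rhs Z2 Z1 (- s) = - pb_rhs Z1 Z2 s.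
Proof. by rewrite /pb_rhs opprK opprB. Qed.

Lemma pb_rhs_homo (R : realType) (Z1 Z2 : R) : 0 < Z1 -> 0 < Z2 ->
  {homo pb_rhs Z1 Z2 : s t / s <= t}.
Proof.
move=> Z10 Z20 s t st; rewrite /pb_rhs lerB//.
  by rewrite ler_pM2r ?invr_gt0// ler_expR.
by rewrite ler_pM2r ?invr_gt0// ler_expR lerN2.
Qed.

(** The potential at which the two species balance: [expR (2 * c) = Z2 / Z1]. *)
Lemma pb_rhs_root (R : realType) (Z1 Z2 : R) : 0 < Z1 -> 0 < Z2 ->
  pb_rhs Z1 Z2 (ln (Z2 / Z1) / 2) = 0.
Proof.
move=> Z10 Z20; set c := _ / 2.
have cE : expR c * expR c = Z2 / Z1.
  by rewrite -expRD /c -splitr lnK// posrE divr_gt0.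
have c0 := expR_gt0 c.
apply/eqP; rewrite /pb_rhs expRN subr_eq0; apply/eqP.
apply: (mulfI (lt0r_neq0 c0)); rewrite mulrA cE.
by field; rewrite !lt0r_neq0.
Qed.

(** A pointwise rate in [eps] with [M], [r] and [k] independent of [eps]; the
    absolute value of the balancing potential covers both [Phi] and [- Phi]. *)
Lemma pb_density_bound (R : realType) (d : nat) (Omega : set 'rV[R]_d)
    (W Phi : 'rV[R]_d -> R) (Z1 Z2 eps M r k : R) (x0 : 'rV[R]_d) :
  open Omega -> bounded_set Omega -> 0 < Z1 -> 0 < Z2 -> 0 < eps ->
  pb_solution Omega W Z1 Z2 eps Phi ->
  (forall x, boundary Omega x -> `|W x| <= M) ->
  0 < r -> ball x0 r `<=` Omega -> 0 <= k ->
  M + `|ln (Z2 / Z1) / 2| <= k * r ^+ 2 ->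
  `|pb_density Z1 Z2 Phi x0| <= d%:R * (2 * k) * eps.
Proof.
move=> oO bO Z10 Z20 eps0 [Phis Phieq PhiW] WM r0 x0O k0.
set c := ln (Z2 / Z1) / 2 => kbig.
have Fc : pb_rhs Z1 Z2 c = 0 by exact: pb_rhs_root.
have cPhi := smooth_on_continuous Phis.
have dPhi x : Omega x -> axis_derivable2 Phi x.
  move=> Ox; apply: (smooth_on_derivable2 Phis).
  by apply: filterS (open_nbhs_nbhs (conj oO Ox)); exact: subset_closure.
have PhiM x : boundary Omega x -> - M <= Phi x <= M.
  by move=> Bx; rewrite PhiW // -ler_norml; exact: WM.
have eqPhi x : Omega x -> eps * laplacian Phi x = pb_rhs Z1 Z2 (Phi x).
  by move=> Ox; have := Phieq x Ox; rewrite pb_densityE mulNr => /oppr_inj.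
have cbound : c <= `|c| /\ - c <= `|c|.
  by split; rewrite ?ler_norm// -normrN ler_norm.
rewrite pb_densityE normrN ler_norml lerNl -pb_rhsN; apply/andP; split.
- have cPhiN : {within closure Omega, continuous (- Phi)}.
    by move=> x; apply: continuousN; exact: cPhi.
  have dPhiN x : Omega x -> axis_derivable2 (- Phi) x.
    by move=> Ox; exact: (axis_derivable2N oO dPhi Ox).
  have PhiNM x : boundary Omega x -> (- Phi) x <= M.
    by move=> Bx; rewrite lerNl; case/andP: (PhiM x Bx).
  have FNc : pb_rhs Z2 Z1 (- c) <= 0 by rewrite pb_rhsN Fc oppr0.
  have eqPhiN x : Omega x ->
      eps * laplacian (- Phi) x = pb_rhs Z2 Z1 ((- Phi) x).
    by move=> Ox; rewrite (laplacianN oO dPhi Ox) mulrN (eqPhi x Ox) -pb_rhsN.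
  apply: (semilinear_interior_bound oO bO cPhiN dPhiN PhiNM
    (pb_rhs_homo Z20 Z10) FNc (ltW eps0) eqPhiN r0 x0O k0); lra.
- have PhiM' x : boundary Omega x -> Phi x <= M.
    by move=> Bx; case/andP: (PhiM x Bx).
  have Fc0 : pb_rhs Z1 Z2 c <= 0 by rewrite Fc.
  apply: (semilinear_interior_bound oO bO cPhi dPhi PhiM'
    (pb_rhs_homo Z10 Z20) Fc0 (ltW eps0) eqPhi r0 x0O k0); lra.
Qed.

(* sup here is the real supremum: sup of the empty set is 0, and for compact K
   the set of values is bounded because the density is continuous on Omega. *)
Theorem theorem1 (R : realType) (d : nat) (hd : d = 2%N \/ d = 3%N)
    (Omega : set 'rV[R]_d) (Omega_open : open Omega)
    (Omega_connected : connected Omega) (Omega_bounded : bounded_set Omega)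
    (Omega_smooth : smooth_boundary Omega)
    (W : 'rV[R]_d -> R) (W_smooth : smooth_on (boundary Omega) W)
    (Z1 Z2 : R) (Z1_gt0 : 0 < Z1) (Z2_gt0 : 0 < Z2)
    (Phi : R -> 'rV[R]_d -> R)
    (Phi_sol : forall eps : R, 0 < eps ->
       pb_solution Omega W Z1 Z2 eps (Phi eps))
    (K : set 'rV[R]_d) (K_compact : compact K) (K_sub : K `<=` Omega) :
  sup [set `|pb_density Z1 Z2 (Phi eps) x| | x in K] @[eps --> 0^'+] --> 0.
Proof.
have [r r0 Kr] := compact_ball_sub_open K_compact Omega_open K_sub.
have [M M0 WM] :=
  boundary_data_bounded Omega_bounded (smooth_on_continuous W_smooth).
pose k := (M + `|ln (Z2 / Z1) / 2|) / r ^+ 2.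
have r20 : 0 < r ^+ 2 by exact: exprn_gt0.
have k0 : 0 <= k by rewrite divr_ge0 ?ltW// ltr_pwDl.
have kE : M + `|ln (Z2 / Z1) / 2| <= k * r ^+ 2 by rewrite divfK ?lt0r_neq0.
pose C := d%:R * (2 * k).
have C0 : 0 <= C by rewrite mulr_ge0 // mulr_ge0.
have bound (eps : R) x : 0 < eps -> K x ->
    `|pb_density Z1 Z2 (Phi eps) x| <= C * eps.
  move=> eps0 Kx.
  have := pb_density_bound Omega_open Omega_bounded Z1_gt0 Z2_gt0 eps0
    (Phi_sol _ eps0) WM r0 (Kr x Kx) k0 kE.
  by rewrite -/C; exact.
apply: (@squeeze_cvgr _ _ _ _ (fun=> 0) (fun eps => C * eps)); first last.
- have : {for 0, continuous (fun eps : R => C * eps)}.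
    exact: mulrl_continuous.
  rewrite /prop_for /continuous_at mulr0; exact: cvg_at_right_filter.
- exact: cvg_cst.
near=> eps.
have eps0 : 0 < eps by near: eps; exact: nbhs_right_gt.
have [K0|/set0P[x Kx]] := eqVneq K set0.
  by rewrite K0 image_set0 sup0 lexx /= mulr_ge0 // ltW.
have Cub : ubound [set `|pb_density Z1 Z2 (Phi eps) x| | x in K] (C * eps).
  by move=> _ [y Ky <-]; exact: bound.
apply/andP; split; last first.
  by apply: ge_sup => //; exists `|pb_density Z1 Z2 (Phi eps) x|, x.
apply: le_trans (normr_ge0 (pb_density Z1 Z2 (Phi eps) x)) _.
by apply: ub_le_sup; [exists (C * eps)|exists x].
Unshelve. all: by end_near. Qed.
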